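(* For every graph $G=(V,E)$ with $n=|V|\ge 2$ vertices and minimum degree $\delta$, and every pair of distinct vertices $s\neq v$ in $V$, $$\mathsf{C}(s,v)\;\le\; 4\cdot\frac{|E|}{\delta}\cdot \mathbf{E}[\mathsf{RBA}(s,v)].$$ Consequently there is an absolute constant $C>0$ such that for every such graph $G$, $$\mathsf{COV}(G)\;\le\; C\cdot\frac{|E|}{\delta}\cdot\log n\cdot \mathbf{E}[\mathsf{RBA}(G)],$$ or equivalently $\mathcal{R}(G)=O\!\left(\frac{|E|}{\delta}\cdot\log n\right)$.
   Context: Graphs are finite, undirected, simple and connected. A random walk on $G$ moves at each step from its current vertex to a neighbor chosen uniformly at random. The hitting time $\mathsf{H}(u,v)$ is the expected number of steps for the walk started at $u$ to reach $v$; the commute time is $\mathsf{C}(u,v)=\mathsf{H}(u,v)+\mathsf{H}(v,u)$. The cover time $\mathsf{COV}(s)$ is the expected number of steps for the walk started at $s$ to visit all vertices, and $\mathsf{COV}(G)=\max_{s\in V}\mathsf{COV}(s)$. Randomized broadcast algorithm $\mathsf{RBA}$ (push algorithm): at time $0$ only a vertex $s$ knows a rumor; at each time step $t=1,2,\dots$ every vertex that knows the rumor chooses, independently, a neighbor uniformly at random and informs it. $I_t$ is the set of informed vertices at time $t$ ($I_0=\{s\}$). $\mathsf{RBA}(s,v)$ is the random time $\min\{t\in\mathbb{N}: v\in I_t\}$ when $I_0=\{s\}$. The expected broadcast time is $\mathbf{E}[\mathsf{RBA}(G)]:=\max_{s\in V}\mathbf{E}[\min\{t: I_t=V\}\text{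 with } I_0=\{s\}]$. Finally $\mathcal{R}(G):=\mathsf{COV}(G)/\mathbf{E}[\mathsf{RBA}(G)]$. *)

(* Defs.v *)
From HB Require Import structures.
From mathcomp Require Import all_boot all_order all_algebra.
From mathcomp Require Import all_classical all_reals all_analysis.

Set Implicit Arguments.
Unset Strict Implicit.
Unset Printing Implicit Defensive.

Import Order.TTheory GRing.Theory Num.Theory.

Local Open Scope ring_scope.

Section MarkovChain.
Context {R : realType} {S : finType}.
Variable p : S -> S -> R.

Fixpoint path_prob (x : S) (w : seq S) : R :=
  if w is y :: w' then p x y * path_prob y w' else 1.

(* A trajectory up to time t is the sequence X_0, ..., X_t, of size t + 1. *)
Definition traj_prob (x : S) (t : nat) (A : pred (seq S)) : R :=
  \sum_(w : t.-tuple S | A (x :: w)) path_prob x w.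

(* A random time is given by the predicate [stop] on trajectories: it is the
   least t such that [stop] holds of X_0, ..., X_t (+oo if there is none). *)
Definition stops_at (stop : pred (seq S)) (t : nat) : pred (seq S) :=
  fun tr => stop tr && [forall k : 'I_t, ~~ stop (take k.+1 tr)].

Definition stop_law (x : S) (stop : pred (seq S)) (t : nat) : R :=
  traj_prob x t (stops_at stop t).

(* The second summand accounts for the event that the time is infinite
   (recall that +oo * 0 = 0). *)
Definition expected_time (x : S) (stop : pred (seq S)) : \bar R :=
  (\sum_(0 <= t <oo) (t%:R * stop_law x stop t)%:E +
   +oo * (1 - \sum_(0 <= t <oo) (stop_law x stop t)%:E))%E.

End MarkovChain.

Section Graph.
Context {V : finType}.
Variable e : rel V.

Definition connected_graph : Prop :=
  [/\ symmetric e, irreflexive e & forall x y, connect e x y].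

Definition edges : {set {set V}} := [set [set x; y] | x in V, y in V & e x y].

Definition degree (x : V) : nat := #|[set y | e x y]|.

(* The default value #|V| exceeds every degree of a loopless graph, so it plays
   no role when V is nonempty. *)
Definition min_degree : nat := \big[minn/#|V|]_(x : V) degree x.

End Graph.

Section RandomWalk.
Context {R : realType} {V : finType}.
Variable e : rel V.

Definition walk_step (x y : V) : R := (e x y)%:R / (degree e x)%:R.

Definition hitting_time (u v : V) : \bar R :=
  expected_time walk_step u (fun tr => v \in tr).

Definition commute_time (u v : V) : \bar R :=
  (hitting_time u v + hitting_time v u)%E.

Definition cover_time_from (s : V) : \bar R :=
  expected_time walk_step s (fun tr => [forall v, v \in tr]).

Definition cover_time : \bar R := \big[maxe/-oo%E]_(s : V) cover_time_from s.

End RandomWalk.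

Section Broadcast.
Context {R : realType} {V : finType}.
Variable e : rel V.

(* A choice function for the informed set I: [c u] is the vertex chosen by u.
   Vertices outside I choose nothing, which is encoded by [c u = u]. *)
Definition choices (I : {set V}) : {set {ffun V -> V}} :=
  [set c : {ffun V -> V} | [forall u in ~: I, c u == u]].

Definition push_step (I J : {set V}) : R :=
  \sum_(c in choices I | I :|: [set c u | u in I] == J)
    \prod_(u in I) walk_step e u (c u).

(* The states are the informed sets: a trajectory is I_0, ..., I_t. *)
Definition rba_time (s v : V) : \bar R :=
  expected_time push_step [set s] (has (fun I : {set V} => v \in I)).

Definition rba_time_from (s : V) : \bar R :=
  expected_time push_step [set s] (fun tr => [set: V] \in tr).

Definition broadcast_time : \bar R := \big[maxe/-oo%E]_(s : V) rba_time_from s.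

End Broadcast.

Definition cover_broadcast_ratio {R : realType} {V : finType} (e : rel V) :
  \bar R := (cover_time e / broadcast_time e)%E.

(* Main.v *)
(* Let h_v be the solution of h_v(v) = 0, h_v = 1 + P h_v off v; it dominates
   the hitting times of v. The function f = h_v - h_s + const is, for the graph
   Laplacian, the potential of a current of D = sum of the degrees from s to v,
   with f(s) - f(v) = h_v(s) + h_s(v). During the broadcast, the minimum M of f
   over the informed set falls from f(s) to f(v), while its mean decrease in one
   step is at most 1/delta times the current through the cut {f >= M}, that is
   D/delta. Hence h_v(s) + h_s(v) <= (D/delta) E[RBA(s, v)], with D <= 4 |E|.

   For the cover time, let H bound all the h_u. Then g_u = 1 + h_u / H takes
   values in [1, 2] and P g_u = g_u - 1/H off u, so by concavity
   3 H ln(1 + sum of g_u(X) over the unvisited u) decreases by 1 per step in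
   mean, which bounds the cover time by its initial value 3 H ln(1 + 2n). *)
Require Import Defs.
From HB Require Import structures.
From mathcomp Require Import all_boot all_order all_algebra.
From mathcomp Require Import all_classical all_reals all_analysis.
From mathcomp Require Import ring lra.

Set Implicit Arguments.
Unset Strict Implicit.
Unset Printing Implicit Defensive.

Import Order.TTheory GRing.Theory Num.Theory.

Local Open Scope ring_scope.

(** * Sums over trajectories of a finite chain *)

Lemma sum_tuple_rcons (R : realType) (S : finType) (n : nat) (G : seq S -> R) :
  \sum_(w : n.+1.-tuple S) G w = \sum_(w : n.-tuple S) \sum_y G (rcons w y).
Proof.
rewrite pair_big /=.
rewrite (reindex (fun q : n.-tuple S * S => [tuple of rcons q.1 q.2])) //=.
apply: onW_bij; apply: inj_card_bij.
  by move=> [w y] [w' y'] /= /(congr1 val) /= /rcons_inj [/val_inj -> ->].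
by rewrite card_prod !card_tuple expnSr.
Qed.

Lemma path_prob_rcons (R : realType) (S : finType) (p : S -> S -> R) x w y :
  path_prob p x (rcons w y) = path_prob p x w * p (last x w) y.
Proof.
by elim: w x => [|z w IH] x /=; rewrite ?mulr1 ?mul1r // IH mulrA.
Qed.

Lemma path_prob_ge0 (R : realType) (S : finType) (p : S -> S -> R) x w :
  (forall y z, 0 <= p y z) -> 0 <= path_prob p x w.
Proof.
by move=> p0; elim: w x => [|z w IH] x //=; rewrite mulr_ge0.
Qed.

(** * Stopped chains and drift bounds for expected stopping times *)

Section StoppedChain.
Context (R : realType) (S : finType).
Variables (p : S -> S -> R) (x : S) (stop : pred (seq S)).
Hypothesis p_ge0 : forall y z, 0 <= p y z.
Hypothesis p_sum1 : forall y, \sum_z p y z = 1.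

(** The event that the stopping time T exceeds [n]. The sequence [w] lists X_1, ..., X_n only; with
    [x] prepended, a prefix of size [k.+1] ends at time [k]. *)
Definition alive (n : nat) (w : seq S) : bool :=
  [forall k : 'I_n.+1, ~~ stop (take k.+1 (x :: w))].

(** The unnormalised expectation E[F; T > n]; likewise [stop_mean] is E[F; T = n] and [survival] is
    P(T > n). *)
Definition alive_mean (n : nat) (F : seq S -> R) : R :=
  \sum_(w : n.-tuple S | alive n w) path_prob p x w * F w.

Definition stop_mean (n : nat) (F : seq S -> R) : R :=
  \sum_(w : n.-tuple S | stops_at stop n (x :: w)) path_prob p x w * F w.

Definition survival (n : nat) : R := alive_mean n (fun=> 1).

Lemma aliveE n w : size w = n ->
  alive n w = ~~ stop (x :: w) &&
              [forall k : 'I_n, ~~ stop (take k.+1 (x :: w))].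
Proof.
move=> sw; apply/forallP/andP => [al|[ns /forallP al] k].
  split; first by have := al ord_max; rewrite /= -sw take_size.
  by apply/forallP => k; exact: (al (widen_ord (leqnSn n) k)).
have := ltn_ord k; rewrite ltnS leq_eqVlt => /orP[/eqP kn|kn].
  by rewrite /= kn -sw take_size.
exact: (al (Ordinal kn)).
Qed.

Lemma alive_rcons n w y : size w = n ->
  [forall k : 'I_n.+1, ~~ stop (take k.+1 (x :: rcons w y))] = alive n w.
Proof.
move=> sw; apply: eq_forallb => k; congr (~~ stop _) => /=.
by rewrite -cats1 takel_cat // sw -ltnS.
Qed.

(** Being alive at [n] depends on the first [n] steps only, so the next step can be averaged
    separately; each extended trajectory is then either alive at [n.+1] or stops exactly there. *)
Lemma alive_mean_step n F :
  alive_mean n (fun w => \sum_y p (last x w) y * F (rcons w y)) =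
  alive_mean n.+1 F + stop_mean n.+1 F.
Proof.
rewrite /alive_mean /stop_mean [X in _ = X + _]big_mkcond.
rewrite [X in _ = _ + X]big_mkcond /= -big_split /=.
rewrite (sum_tuple_rcons n (fun w =>
  (if alive n.+1 w then path_prob p x w * F w else 0) +
  (if stops_at stop n.+1 (x :: w) then path_prob p x w * F w else 0))).
rewrite big_mkcond /=; apply: eq_bigr => w _.
transitivity (\sum_y (if alive n w then
    path_prob p x (rcons w y) * F (rcons w y) else 0)).
  case: ifP => _; last by rewrite big1.
  by rewrite mulr_sumr; apply: eq_bigr => y _; rewrite path_prob_rcons mulrA.
apply: eq_bigr => y _.
rewrite (@aliveE n.+1); last by rewrite size_rcons size_tuple.
rewrite /stops_at (@alive_rcons n) ?size_tuple //.
by case: (stop _); case: (alive _ _); rewrite /= ?addr0 ?add0r.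
Qed.

Lemma alive_mean_le n (F G : seq S -> R) :
  (forall w : n.-tuple S, alive n w -> F w <= G w) ->
  alive_mean n F <= alive_mean n G.
Proof.
by move=> FG; apply: ler_sum => w /FG; apply: ler_wpM2l; apply: path_prob_ge0.
Qed.

Lemma alive_meanD n (F G : seq S -> R) :
  alive_mean n (fun w => F w + G w) = alive_mean n F + alive_mean n G.
Proof. by rewrite -big_split; apply: eq_bigr => w _; rewrite mulrDr. Qed.

Lemma alive_meanZ n (a : R) : alive_mean n (fun=> a) = a * survival n.
Proof. by rewrite mulr_sumr; apply: eq_bigr => w _; rewrite mulr1 mulrC. Qed.

Lemma survival_ge0 n : 0 <= survival n.
Proof. by apply: sumr_ge0 => w _; rewrite mulr1 path_prob_ge0. Qed.

Lemma stop_law_ge0 n : 0 <= stop_law p x stop n.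
Proof. by apply: sumr_ge0 => w _; rewrite path_prob_ge0. Qed.

Lemma survivalS n : survival n = survival n.+1 + stop_law p x stop n.+1.
Proof.
have -> : stop_law p x stop n.+1 = stop_mean n.+1 (fun=> 1).
  by apply: eq_bigr => w _; rewrite mulr1.
rewrite -alive_mean_step; apply: eq_bigr => w _; congr (_ * _).
by rewrite -[LHS](p_sum1 (last x w)); apply: eq_bigr => y _; rewrite mulr1.
Qed.

Lemma alive_mean0 F : alive_mean 0 F = (if stop [:: x] then 0 else F [::]).
Proof.
rewrite /alive_mean big_mkcond /= (big_pred1 [tuple]) /=; last first.
  by move=> t; apply/esym/eqP; apply: tuple0.
rewrite aliveE // /= mul1r.
have -> : [forall k : 'I_0, ~~ stop (x :: take k [::])] by apply/forallP => -[].
by rewrite andbT; case: (stop _).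
Qed.

Lemma stop_mean0 F : stop_mean 0 F = (if stop [:: x] then F [::] else 0).
Proof.
rewrite /stop_mean big_mkcond /= (big_pred1 [tuple]) /=; last first.
  by move=> t; apply/esym/eqP; apply: tuple0.
rewrite /stops_at /= mul1r.
have -> : [forall k : 'I_0, ~~ stop (x :: take k [::])] by apply/forallP => -[].
by rewrite andbT; case: (stop _).
Qed.

Lemma sum_stop_law n :
  \sum_(0 <= t < n.+1) stop_law p x stop t = 1 - survival n.
Proof.
elim: n => [|n IH].
  rewrite big_nat1.
  have -> : stop_law p x stop 0 = stop_mean 0 (fun=> 1).
    by apply: eq_bigr => w _; rewrite mulr1.
  by rewrite stop_mean0 /survival alive_mean0; case: (stop _); lra.
by rewrite big_nat_recr //= IH (survivalS n); lra.
Qed.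

(** Summation by parts, with the boundary term left by the truncation at [n]. *)
Lemma sum_time_stop_law n :
  \sum_(0 <= t < n.+1) t%:R * stop_law p x stop t =
  \sum_(0 <= k < n) survival k - n%:R * survival n.
Proof.
elim: n => [|n IH]; first by rewrite big_nat1 big_geq // mul0r mul0r subr0.
rewrite big_nat_recr //= IH big_nat_recr //= (survivalS n) -[n.+1%:R]natr1.
by lra.
Qed.

Lemma survival_homo m n : (m <= n)%N -> survival n <= survival m.
Proof.
move=> /subnK <-; elim: (n - m)%N => [//|k IH]; apply: le_trans IH.
by rewrite addSn (survivalS (k + m)) lerDl stop_law_ge0.
Qed.

Lemma survival_le_sum n : n%:R * survival n <= \sum_(0 <= k < n) survival k.
Proof.
elim: n => [|n IH]; first by rewrite mul0r big_geq.
rewrite big_nat_recr //= -natr1 mulrDl mul1r.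
have h := @survival_homo n n.+1 (leqnSn n).
by apply: lerD => //; apply: le_trans IH; apply: ler_wpM2l.
Qed.

(** The mass that stops after [n] and no later than [m] is weighted by times of at least [n]. *)
Lemma tail_time_stop_law m n : (n <= m)%N ->
  \sum_(0 <= t < n.+1) t%:R * stop_law p x stop t +
    n%:R * (survival n - survival m) <=
  \sum_(0 <= t < m.+1) t%:R * stop_law p x stop t.
Proof.
move=> /subnK <-; elim: (m - n)%N => [|k IH]; first by rewrite subrr mulr0 addr0.
rewrite addSn [leRHS]big_nat_recr //=; set T := \sum_(_ <= _ < (k + n).+1) _ in IH *.
have -> : n%:R * (survival n - survival (k + n).+1) =
   n%:R * (survival n - survival (k + n)) +
   n%:R * stop_law p x stop (k + n).+1.
  by rewrite (survivalS (k + n)); lra.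
rewrite addrA; apply: lerD => //; apply: ler_wpM2r; first exact: stop_law_ge0.
by rewrite ler_nat -addSn leq_addl.
Qed.

Local Notation mean_sum :=
  (\sum_(0 <= t <oo) (t%:R * stop_law p x stop t)%:E)%E.
Local Notation law_sum := (\sum_(0 <= t <oo) (stop_law p x stop t)%:E)%E.

Lemma nneseriesEFin_le (u : nat -> R) (b : \bar R) : (forall t, 0 <= u t) ->
  (forall n, (\sum_(0 <= t < n.+1) u t)%:E <= b)%E ->
  (\sum_(0 <= t <oo) (u t)%:E <= b)%E.
Proof.
move=> u0 ub; apply: lime_le.
  by apply: is_cvg_nneseries => n _ _; rewrite lee_fin.
apply: nearW => -[|n]; last by rewrite sumEFin.
rewrite big_geq //; apply: le_trans (ub 0%N).
by rewrite lee_fin sumr_ge0.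
Qed.

Lemma nneseriesEFin_ge (u : nat -> R) n : (forall t, 0 <= u t) ->
  ((\sum_(0 <= t < n.+1) u t)%:E <= \sum_(0 <= t <oo) (u t)%:E)%E.
Proof.
move=> u0; rewrite -sumEFin; apply: nneseries_lim_ge => t _ _.
by rewrite lee_fin.
Qed.

Lemma time_law_ge0 t : 0 <= t%:R * stop_law p x stop t.
Proof. by rewrite mulr_ge0 // stop_law_ge0. Qed.

Lemma law_sum_le1 : (law_sum <= 1)%E.
Proof.
apply: nneseriesEFin_le => [t|n]; first exact: stop_law_ge0.
by rewrite sum_stop_law lee_fin gerBl survival_ge0.
Qed.

(** Supermartingale argument: [F] pays for each surviving step, so the tails P(T > k) sum to at most
    [F [::]]. This also forces them to 0, which removes the infinite summand of [expected_time]. *)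
Lemma expected_time_le (F : seq S -> R) :
  (forall w, 0 <= F w) ->
  (forall w, alive (size w) w ->
    1 + \sum_y p (last x w) y * F (rcons w y) <= F w) ->
  (expected_time p x stop <= (F [::])%:E)%E.
Proof.
move=> F0 drift.
have means n : \sum_(0 <= k < n) survival k + alive_mean n F <= F [::].
  elim: n => [|n IH].
    by rewrite big_geq // add0r alive_mean0; case: (stop _).
  apply: le_trans IH; rewrite big_nat_recr //= -addrA lerD2l.
  have : alive_mean n (fun w => 1 + \sum_y p (last x w) y * F (rcons w y))
         <= alive_mean n F.
    by apply: alive_mean_le => w al; apply: drift; rewrite size_tuple.
  rewrite alive_meanD alive_mean_step; apply: le_trans.
  rewrite lerD2l lerDl; apply: sumr_ge0 => w _.
  by rewrite mulr_ge0 // path_prob_ge0.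
have sums n : \sum_(0 <= k < n) survival k <= F [::].
  apply: le_trans (means n); rewrite lerDl; apply: sumr_ge0 => w _.
  by rewrite mulr_ge0 // path_prob_ge0.
have mean_le : (mean_sum <= (F [::])%:E)%E.
  apply: nneseriesEFin_le => [|n]; first exact: time_law_ge0.
  rewrite lee_fin sum_time_stop_law; apply: le_trans (sums n).
  by rewrite gerBl mulr_ge0 // survival_ge0.
have law1 : (law_sum = 1)%E.
  apply/eqP; rewrite eq_le law_sum_le1 /=; apply/lee_addgt0Pr => eps eps0.
  (* Tails decrease, so n P(T > n) is at most their sum, hence at most [F [::]]; this [n] brings P(T
     > n) down to [eps]. *)
  pose n := (Num.truncn (F [::] / eps)).+1.
  have nF : F [::] / eps < n%:R by apply: truncnS_gt.
  apply: (@le_trans _ _ ((\sum_(0 <= t < n.+1) stop_law p x stop t)%:E + eps%:E)%E).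
    rewrite -EFinD lee_fin sum_stop_law.
    have : n%:R * survival n <= n%:R * eps.
      apply: (le_trans (survival_le_sum n)); apply: (le_trans (sums n)).
      by rewrite -ler_pdivrMr // ltW.
    by rewrite ler_pM2l // => ?; lra.
  by apply: leeD => //; apply: nneseriesEFin_ge => t; apply: stop_law_ge0.
by rewrite /expected_time law1 subee // mule0 adde0.
Qed.

(** Submartingale counterpart: stopped trajectories contribute nothing positive, and the upper bound
    [b] makes the surviving part E[F; T > n] at most a multiple of P(T > n). *)
Lemma expected_time_ge (F : seq S -> R) (b : R) :
  (forall w, F w <= b) ->
  (forall w, alive (size w) w ->
    F w <= 1 + \sum_y p (last x w) y * F (rcons w y)) ->
  (forall w, stops_at stop (size w) (x :: w) -> F w <= 0) ->
  ((F [::])%:E <= expected_time p x stop)%E.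
Proof.
move=> Fb drift Fstop.
have stopF n : stop_mean n F <= 0.
  rewrite -oppr_ge0 -sumrN; apply: sumr_ge0 => w st.
  rewrite -mulrN mulr_ge0 ?path_prob_ge0 // oppr_ge0; apply: Fstop.
  by rewrite size_tuple.
have means n : F [::] <= \sum_(0 <= k < n) survival k + alive_mean n F.
  elim: n => [|n IH].
    rewrite big_geq // add0r alive_mean0; have := stopF 0%N.
    by rewrite stop_mean0; case: (stop _).
  apply: le_trans IH _; rewrite big_nat_recr //= -addrA lerD2l.
  have : alive_mean n F <=
         alive_mean n (fun w => 1 + \sum_y p (last x w) y * F (rcons w y)).
    by apply: alive_mean_le => w al; apply: drift; rewrite size_tuple.
  rewrite alive_meanD alive_mean_step => /le_trans; apply.
  by rewrite lerD2l gerDl.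
pose B := Num.max b 1.
have B0 : 0 < B by rewrite /B lt_max ltr01 orbT.
have bounds n : alive_mean n F <= B * survival n.
  rewrite -alive_meanZ; apply: alive_mean_le => w _.
  by rewrite /B le_max Fb.
have mean0 : (0 <= mean_sum)%E.
  by apply: nneseries_ge0 => t _ _; rewrite lee_fin time_law_ge0.
rewrite /expected_time.
(* If T is infinite with positive probability, the second summand is +oo and the bound is
   trivial. *)
have := law_sum_le1; rewrite le_eqVlt => /orP[/eqP law1|lawlt1]; last first.
  rewrite gt0_mulye ?sube_gt0 // addey ?leey //.
  by rewrite gt_eqF // (lt_le_trans _ mean0) // ltNy0.
rewrite law1 subee // mule0 adde0.
have small eps : 0 < eps -> exists n, survival n < eps.
  move=> eps0; apply: contrapT => /forallNP sm.
  have : (law_sum <= (1 - eps)%:E)%E.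
    apply: nneseriesEFin_le => [t|n]; first exact: stop_law_ge0.
    rewrite sum_stop_law lee_fin lerB //; have /negP := sm n.
    by rewrite -leNgt.
  by rewrite law1 lee_fin => ?; lra.
apply/lee_addgt0Pr => eps eps0.
(* Half of [eps] absorbs the surviving part at time [n]; the other half absorbs [n] times the mass
   still alive at the later truncation time. Dividing by [n.+1] covers the case n = 0. *)
have [n sn] : exists n, survival n < eps / 2 / B.
  by apply: small; rewrite !divr_gt0.
have [m sm] : exists m, survival m < eps / 2 / n.+1%:R.
  by apply: small; rewrite !divr_gt0.
have nm : survival (maxn m n) < eps / 2 / n.+1%:R.
  by apply: le_lt_trans sm; apply: survival_homo; rewrite leq_maxl.
apply: (@le_trans _ _ ((\sum_(0 <= t < (maxn m n).+1)
    t%:R * stop_law p x stop t)%:E + eps%:E)%E); last first.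
  by apply: leeD => //; apply: nneseriesEFin_ge; exact: time_law_ge0.
rewrite -EFinD lee_fin.
have := @tail_time_stop_law (maxn m n) n (leq_maxr _ _).
rewrite sum_time_stop_law.
have := means n; have := bounds n.
move: sn; rewrite ltr_pdivlMr // mulrC => sn.
move: nm; rewrite ltr_pdivlMr // -natr1 mulrDr mulr1 mulrC => nm.
have := survival_ge0 (maxn m n).
set T := \sum_(_ <= _ < _.+1) _; set U := \sum_(_ <= _ < n) _.
by move=> *; lra.
Qed.

End StoppedChain.

(** * Degrees, edges and the Laplacian of the walk *)

Lemma sum_antisymmetric (R : realType) (S : finType) (P : pred S)
    (F : S -> S -> R) :
  (forall x y, F x y = - F y x) -> \sum_(x | P x) \sum_(y | P y) F x y = 0.
Proof.
move=> anti; set T := \sum_(x | P x) _.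
have /eqP : T = - T.
  rewrite {1}/T exchange_big -sumrN; apply: eq_bigr => y _.
  by rewrite -sumrN; apply: eq_bigr => x _; exact: anti.
by rewrite -addr_eq0 -mulr2n mulrn_eq0 => /eqP.
Qed.

Section WalkAndPush.
Context (R : realType) (V : finType) (e : rel V).
Hypothesis conn : connected_graph e.
Hypothesis V2 : (2 <= #|V|)%N.

Local Notation p := (@walk_step R V e).

Definition degree_sum : R := \sum_(x : V) (degree e x)%:R.

Lemma degree_gt0 x : (0 < degree e x)%N.
Proof.
have [_ _ cn] := conn.
have [y xy] : exists y, y != x.
  apply/existsP; apply: contraLR V2 => /existsPn all_x.
  rewrite -leqNgt -(card1 x) subset_leq_card //; apply/fintype.subsetP => y _.
  by have := all_x y; rewrite negbK inE.
have /connectP [[|z w] /= pth yl] := cn x y; first by rewrite yl eqxx in xy.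
by apply/card_gt0P; exists z; rewrite inE; case/andP: pth.
Qed.

Lemma min_degree_le x : (min_degree e <= degree e x)%N.
Proof.
rewrite /min_degree; elim: (index_enum V) (mem_index_enum x) => //= y r IH.
rewrite inE big_cons geq_min => /predU1P[<-|/IH ->]; first by rewrite leqnn.
by rewrite orbT.
Qed.

Lemma min_degree_gt0 : (0 < min_degree e)%N.
Proof.
apply: (big_ind (fun m => 0 < m)%N); first exact: ltn_trans V2.
  by move=> a b a0 b0; rewrite leq_min a0.
by move=> x _; exact: degree_gt0.
Qed.

(** Ordered adjacent pairs are grouped by the edge they span; the fibre over an edge {x, y} lies in
    the square of {x, y}, which gives the factor 4. *)
Lemma degree_sum_le : degree_sum <= 4 * #|edges e|%:R.
Proof.
have -> : degree_sum = #|[set q : V * V | e q.1 q.2]|%:R.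
  rewrite /degree_sum -natr_sum; congr (_%:R).
  rewrite (eq_bigr (fun x => \sum_(y | e x y) 1)%N); last first.
    by move=> x _; rewrite sum1_card /degree cardsE.
  rewrite (pair_big_dep xpredT (fun x y => e x y) (fun _ _ => 1%N)) /=.
  by rewrite sum1_card cardsE.
rewrite -natrM ler_nat mulnC -sum_nat_const -sum1_card.
rewrite (partition_big (fun q => [set q.1; q.2]) (mem (edges e))) /=; last first.
  move=> [x y]; rewrite inE /= => exy; apply/imset2P.
  by exists x y; rewrite ?inE.
apply: leq_sum => E /imset2P [x y _ _ ->].
rewrite sum1_card; apply: (@leq_trans #|finset.setX [set x; y] [set x; y]|).
  apply: subset_leq_card; apply/fintype.subsetP => -[a b].
  rewrite unfold_in /= => /andP[_ /eqP ab].
  by rewrite finset.in_setX -ab !inE !eqxx orbT.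
by rewrite cardsX cards2; case: (x != y).
Qed.

Lemma walk_step_ge0 x y : 0 <= p x y.
Proof. by rewrite divr_ge0. Qed.

Lemma degree_natE x : (degree e x)%:R = \sum_y (e x y)%:R :> R.
Proof.
by rewrite -natr_sum /degree -sum1_card big_mkcond; congr (_%:R);
  apply: eq_bigr => y _; rewrite inE; case: (e x y).
Qed.

Lemma degree_neq0 x : (degree e x)%:R != 0 :> R.
Proof. by rewrite pnatr_eq0 -lt0n degree_gt0. Qed.

Lemma walk_step_sum1 x : \sum_y p x y = 1.
Proof. by rewrite -mulr_suml -degree_natE divff // degree_neq0. Qed.

(** Passes from the symmetric form, where currents cancel in pairs, to the averaging form of the
    hitting equations. *)
Lemma laplacianE (g : V -> R) x :
  \sum_y (e x y)%:R * (g x - g y) =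
  (degree e x)%:R * (g x - \sum_y p x y * g y).
Proof.
rewrite mulrBr mulr_sumr degree_natE mulr_suml -sumrB -degree_natE.
apply: eq_bigr => y _; rewrite mulrBr /walk_step mulrA mulrCA mulrA mulfK //.
exact: degree_neq0.
Qed.

(** * Minimum principle and the hitting equations *)

Lemma superharmonic_ge0 (g : V -> R) v :
  0 <= g v -> (forall u, u != v -> \sum_w p u w * g w <= g u) ->
  forall u, 0 <= g u.
Proof.
(* A negative minimum, attained at [x], would spread along edges all the way to [v], where [g] is
   nonnegative. *)
move=> gv sup; have [x _ xmin] := arg_minP g (isT : xpredT v).
suff : 0 <= g x by move=> x0 u; apply: le_trans x0 (xmin u isT).
rewrite leNgt; apply/negP => gx0.
suff vx : g v = g x by move: gv; rewrite vx leNgt gx0.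
have [_ _ cn] := conn; have /connectP [w pth ->] := cn x v.
suff step u z : e u z -> g u = g x -> g z = g x.
  have walk y r : path e y r -> g y = g x -> g (last y r) = g x.
    by elim: r y => [|z r IH] y //= /andP[yz pr] gy; apply/IH/(step y).
  exact: walk pth _.
move=> uz gu; have uv : u != v.
  by apply/eqP => uv; move: gv; rewrite -uv gu leNgt gx0.
(* At a minimiser all these terms are nonnegative, while superharmonicity makes their sum
   nonpositive; so every neighbor is a minimiser too. *)
have deg0 : \sum_w (e u w)%:R * (g w - g u) == 0.
  rewrite eq_le; apply/andP; split; last first.
    by apply: sumr_ge0 => y _; rewrite mulr_ge0 // subr_ge0 gu xmin.
  rewrite -oppr_ge0 -sumrN (eq_bigr (fun y => (e u y)%:R * (g u - g y))).
    by rewrite laplacianE mulr_ge0 // subr_ge0 sup.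
  by move=> y _; rewrite -mulrN opprB.
move: deg0; rewrite psumr_eq0; last first.
  by move=> y _; rewrite mulr_ge0 // subr_ge0 gu xmin.
move=> /allP /(_ z (mem_index_enum z)) /=; rewrite uz mul1r subr_eq0 gu.
by move/eqP.
Qed.

Definition hitting_solution (v : V) (h : V -> R) : Prop :=
  [/\ h v = 0, forall u, u != v -> h u = 1 + \sum_w p u w * h w
    & forall u, 0 <= h u].

(** The linear system is square, so a trivial kernel suffices: the minimum principle applies there
    to both [g] and [- g]. Nonnegativity of the solution is the same principle again. *)
Lemma hitting_solution_exists v : exists h, hitting_solution v h.
Proof.
(* [K] is the identity minus the walk killed at [v]; [A] is its transpose because it acts on row
   vectors. *)
pose K := fun u w => (u == w)%:R - (u != v)%:R * p u w.
pose A := \matrix_(i < #|V|, j < #|V|) K (enum_val j) (enum_val i).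
have AE (c : 'rV_#|V|) j :
    (c *m A) 0 j = c 0 j -
      (enum_val j != v)%:R * \sum_w p (enum_val j) w * c 0 (enum_rank w).
  rewrite mxE /K.
  rewrite (reindex (@enum_rank V)) /=; last exact: onW_bij (@enum_rank_bij V).
  under eq_bigr do rewrite mxE enum_rankK /K mulrBr.
  rewrite sumrB; congr (_ - _).
    rewrite (bigD1 (enum_val j)) //= eqxx mulr1 enum_valK big1 ?addr0 //.
    by move=> w /negPf wj; rewrite eq_sym wj mulr0.
  by rewrite mulr_sumr; apply: eq_bigr => w _; rewrite mulrC mulrA.
have unitA : A \in unitmx.
  rewrite -row_free_unit; apply: inj_row_free => c cA0.
  pose g u := c 0 (enum_rank u).
  have gE u : g u = (u != v)%:R * \sum_w p u w * g w.
    have := AE c (enum_rank u); rewrite cA0 mxE enum_rankK.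
    by move=> /esym/subr0_eq.
  have gv : g v = 0 by rewrite gE eqxx mul0r.
  have harm u : u != v -> g u = \sum_w p u w * g w.
    by move=> uv; rewrite {1}gE uv mul1r.
  have g0 := @superharmonic_ge0 g v.
  have gN0 := @superharmonic_ge0 (fun u => - g u) v.
  apply/rowP => j; rewrite mxE -[j]enum_valK -/(g (enum_val j)).
  apply/eqP; rewrite eq_le g0 ?gv //; last by move=> u /harm ->.
  rewrite -oppr_ge0 gN0 ?gv ?oppr0 // => u /harm ->.
  by rewrite -sumrN; apply: ler_sum => w _; rewrite mulrN.
pose c := (\row_j (enum_val j != v)%:R : 'rV[R]_#|V|) *m invmx A.
have cA : c *m A = \row_j (enum_val j != v)%:R by rewrite mulmxKV.
pose h u := c 0 (enum_rank u).
have hE u : h u = (u != v)%:R + (u != v)%:R * \sum_w p u w * h w.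
  have := AE c (enum_rank u); rewrite cA mxE enum_rankK.
  by move/esym/eqP; rewrite subr_eq => /eqP.
have hv : h v = 0 by rewrite hE eqxx mul0r addr0.
have hS u : u != v -> h u = 1 + \sum_w p u w * h w.
  by move=> uv; rewrite {1}hE uv mul1r.
exists h; split => //; apply: (@superharmonic_ge0 h v); first by rewrite hv.
by move=> u /hS ->; rewrite lerDr.
Qed.

(** Along the walk [h] falls by exactly 1 in mean until [v] is hit. *)
Lemma hitting_time_le v h u : hitting_solution v h ->
  (@hitting_time R V e u v <= (h u)%:E)%E.
Proof.
move=> [hv hS h0]; rewrite /hitting_time.
apply: (@expected_time_le _ _ _ u _ walk_step_ge0 walk_step_sum1
  (fun w => h (last u w))) => // w.
rewrite aliveE // => /andP[vw _].
rewrite (hS (last u w)); last first.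
  by apply: contraNneq vw => <-; rewrite mem_last.
by under eq_bigr do rewrite last_rcons.
Qed.

(** Off [v] this is the hitting equation; the value at [v] is forced because the divergences of a
    current sum to 0 over the graph. *)
Lemma laplacian_hitting v h u : hitting_solution v h ->
  \sum_w (e u w)%:R * (h u - h w) =
  (degree e u)%:R - degree_sum * (u == v)%:R.
Proof.
move=> [hv hS h0].
have off z : z != v -> \sum_w (e z w)%:R * (h z - h w) = (degree e z)%:R.
  by move=> zv; rewrite laplacianE hS // addrK mulr1.
have [->|uv] := eqVneq u v; last by rewrite off // mulr0 subr0.
have tot : \sum_z \sum_w (e z w)%:R * (h z - h w) = 0.
  have [sym _ _] := conn.
  by apply: sum_antisymmetric => z w; rewrite sym -mulrN opprB.
move: tot; rewrite (bigD1 v) //= (eq_bigr _ off) => tot.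
rewrite [degree_sum](bigD1 v) //= mulr1.
by apply/eqP; rewrite opprD addrA subrr add0r -addr_eq0; apply/eqP.
Qed.

(** * The push process: drift of one round and lower bound on broadcast times *)

Local Notation D := degree_sum.
Local Notation delta := (min_degree e)%:R.
Local Notation q := (@push_step R V e).

Lemma min_degree_gt0R : 0 < delta :> R.
Proof. by rewrite ltr0n min_degree_gt0. Qed.

Lemma degree_sum_gt0 : 0 < D.
Proof.
have [x _] : exists x : V, x \in V by apply/card_gt0P; apply: ltn_trans V2.
rewrite /D (bigD1 x) //= ltr_pwDl ?ltr0n ?degree_gt0 //.
by apply: sumr_ge0 => y _.
Qed.

Lemma sum_choices (I : {set V}) (F : V -> V -> R) :
  \sum_(c in choices I) \prod_(u in I) F u (c u) =
  \prod_(u in I) \sum_w F u w.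
Proof.
(* A vertex outside [I] gets the point mass at itself, matching the convention [c u = u], so that
   the sum over all functions factors. *)
transitivity (\prod_u \sum_w (if u \in I then F u w else (w == u)%:R)).
  rewrite bigA_distr_bigA big_mkcond /=; apply: eq_bigr => c _.
  rewrite inE; case: ifPn => [/forallP cI|].
    rewrite big_mkcond /=; apply: eq_bigr => u _; case: ifPn => // uI.
    by have := cI u; rewrite inE uI /= => ->.
  rewrite negb_forall => /existsP [u]; rewrite negb_imply inE => /andP[uI cu].
  by rewrite (bigD1 u) //= (negPf uI) (negPf cu) mul0r.
rewrite [RHS]big_mkcond /=; apply: eq_bigr => u _; case: ifP => // _.
by rewrite (bigD1 u) //= eqxx big1 ?addr0 // => w /negPf ->.
Qed.

Lemma push_mean (I : {set V}) (f : {set V} -> R) :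
  \sum_J q I J * f J =
  \sum_(c in choices I) (\prod_(u in I) p u (c u)) *
    f (I :|: [set c u | u in I])%SET.
Proof.
rewrite [RHS](partition_big (fun c : {ffun V -> V} =>
  (I :|: [set c u | u in I])%SET) xpredT) //=; apply: eq_bigr => J _.
by rewrite mulr_suml; apply: eq_bigr => c /andP[_ /eqP ->].
Qed.

Lemma sum_choices_walk (I : {set V}) :
  \sum_(c in choices I) \prod_(u in I) p u (c u) = 1.
Proof. by rewrite sum_choices big1 // => u _; exact: walk_step_sum1. Qed.

Lemma push_step_ge0 I J : 0 <= q I J.
Proof.
by apply: sumr_ge0 => c _; apply: prodr_ge0 => u _; exact: walk_step_ge0.
Qed.

Lemma push_step_sum1 I : \sum_J q I J = 1.
Proof.
have := push_mean I (fun=> 1).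
under eq_bigr do rewrite mulr1.
by move=> ->; under eq_bigr do rewrite mulr1; exact: sum_choices_walk.
Qed.

Lemma choice_marginal (I : {set V}) u (g : V -> R) : u \in I ->
  \sum_(c in choices I) (\prod_(x in I) p x (c x)) * g (c u) =
  \sum_w p u w * g w.
Proof.
(* Only the factor of [u] carries [g]; by independence the others sum to 1. *)
move=> uI; pose F x w := p x w * (if x == u then g w else 1).
have -> : \sum_w p u w * g w = \prod_(x in I) \sum_w F x w.
  rewrite [RHS](bigD1 u) //= [X in _ = _ * X]big1 ?mulr1.
    by apply: eq_bigr => w _; rewrite /F eqxx.
  move=> x /andP[_ /negPf xu]; rewrite -[RHS](walk_step_sum1 x).
  by apply: eq_bigr => w _; rewrite /F xu mulr1.
rewrite -sum_choices; apply: eq_bigr => c _.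
rewrite [RHS]big_split /=; congr (_ * _).
by rewrite (bigD1 u) //= eqxx big1 ?mulr1 // => x /andP[_ /negPf ->].
Qed.

(* The edges leaving [I] downwards below M are among those of the level cut
   {f >= M}, whose total current bounds the sum. *)
Lemma level_cut_bound (I : {set V}) (f : V -> R) (M : R) s :
  (forall u, \sum_w (e u w)%:R * (f u - f w) <= D * (u == s)%:R) ->
  (forall u, u \in I -> M <= f u) ->
  \sum_(u in I) \sum_w p u w * Num.max 0 (M - f w) <= D / delta.
Proof.
move=> lap MI; have [sym _ _] := conn.
pose X := [set u | M <= f u].
pose B := \sum_(u in X) \sum_(w | w \notin X) (e u w)%:R * (f u - f w).
have B_ge0 u w : u \in X -> w \notin X -> 0 <= (e u w)%:R * (f u - f w).
  rewrite !inE -ltNge => Mu wM; rewrite mulr_ge0 // subr_ge0.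
  by apply: ltW (lt_le_trans wM Mu).
(* Currents inside [X] cancel in pairs, so the flow through the cut is the sum of the divergences
   over [X], where only [s] can contribute positively. *)
have inner : \sum_(u in X) \sum_(w in X) (e u w)%:R * (f u - f w) = 0.
  by apply: sum_antisymmetric => z w; rewrite sym -mulrN opprB.
have BD : B <= D.
  have -> : B = \sum_(u in X) \sum_w (e u w)%:R * (f u - f w).
    rewrite -[B]add0r -{1}inner -big_split /=; apply: eq_bigr => u _.
    by rewrite [RHS](bigID (mem X)).
  apply: le_trans (ler_sum _ (fun u _ => lap u)) _.
  rewrite -mulr_sumr -[leRHS]mulr1 ler_pM2l ?degree_sum_gt0 //.
  rewrite big_mkcond (bigD1 s) //= eqxx big1 ?addr0; first by case: ifP.
  by move=> u /negPf ->; case: ifP.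
apply: le_trans (_ : B / delta <= _); last first.
  by rewrite ler_pM2r // invr_gt0 min_degree_gt0R.
rewrite /B mulr_suml big_mkcond [leRHS]big_mkcond /=; apply: ler_sum => u _.
case: ifPn => uI; last first.
  case: ifP => // uX; rewrite divr_ge0 //.
  by apply: sumr_ge0 => w wX; exact: B_ge0.
have uX : u \in X by rewrite inE MI.
(* Termwise: a vertex [w] of the level set gives 0 on both sides; otherwise [M <= f u] and the
   minimum degree give the inequality. *)
rewrite uX mulr_suml [leRHS]big_mkcond /=; apply: ler_sum => w _.
rewrite inE -ltNge; case: ifP => fw; last first.
  by rewrite max_l ?mulr0 // subr_le0 leNgt fw.
rewrite max_r; last by rewrite subr_ge0 ltW.
rewrite /walk_step mulrAC; apply: ler_pM.
- by rewrite mulr_ge0 // subr_ge0 ltW.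
- by rewrite invr_ge0.
- by rewrite ler_wpM2l // lerB // MI.
rewrite lef_pV2 ?ler_nat ?min_degree_le //.
  by rewrite posrE ltr0n degree_gt0.
by rewrite posrE min_degree_gt0R.
Qed.

(** One round lowers the minimum by at most the sum of the undershoots of the chosen vertices below
    [M]; the mean of that sum depends only on the marginals and is bounded by the level cut. *)
Lemma push_min_drift (I : {set V}) (f : V -> R) (a : R) s :
  (forall u, \sum_w (e u w)%:R * (f u - f w) <= D * (u == s)%:R) ->
  \big[Num.min/a]_(u in I) f u - D / delta <=
  \sum_J q I J * \big[Num.min/a]_(u in J) f u.
Proof.
move=> lap; set M := \big[Num.min/a]_(u in I) f u.
have MI u : u \in I -> M <= f u by move=> uI; exact: bigmin_le_cond.
have Ma : M <= a by exact: bigmin_le_id.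
have drop (c : {ffun V -> V}) : M - \sum_(u in I) Num.max 0 (M - f (c u)) <=
    \big[Num.min/a]_(u in (I :|: [set c u | u in I])%SET) f u.
  have sum0 : 0 <= \sum_(u in I) Num.max 0 (M - f (c u)).
    by apply: sumr_ge0 => u _; rewrite le_max lexx.
  apply: le_bigmin => [|x]; first by lra.
  rewrite inE => /orP[/MI Mx|/imsetP [u uI ->]]; first by lra.
  rewrite (bigD1 u) //=.
  have : 0 <= \sum_(i in I | i != u) Num.max 0 (M - f (c i)).
    by apply: sumr_ge0 => y _; rewrite le_max lexx.
  have : M - f (c u) <= Num.max 0 (M - f (c u)) by rewrite le_max lexx orbT.
  by move=> *; lra.
rewrite push_mean.
have := level_cut_bound lap MI.
have -> : \sum_(u in I) \sum_w p u w * Num.max 0 (M - f w) =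
    \sum_(c in choices I) (\prod_(x in I) p x (c x)) *
      \sum_(u in I) Num.max 0 (M - f (c u)).
  under [RHS]eq_bigr do rewrite mulr_sumr.
  rewrite [RHS]exchange_big /=; apply: eq_bigr => u uI.
  by rewrite (choice_marginal (fun w => Num.max 0 (M - f w)) uI).
move=> cut; apply: (@le_trans _ _ (\sum_(c in choices I)
    (\prod_(x in I) p x (c x)) *
      (M - \sum_(u in I) Num.max 0 (M - f (c u))))).
  under eq_bigr do rewrite mulrBr.
  by rewrite sumrB -mulr_suml sum_choices_walk mul1r lerB.
apply: ler_sum => c _; apply: ler_wpM2l (drop c).
by apply: prodr_ge0 => u _; exact: walk_step_ge0.
Qed.

(** Scaling the minimum of [f] by [delta / D] makes its mean decrease at most 1 per round. The
    general [A] covers both the informing of [v] and the full broadcast. *)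
Lemma push_time_ge s v hs hv (A : pred {set V}) :
  hitting_solution s hs -> hitting_solution v hv ->
  (forall I, A I -> v \in I) ->
  ((delta / D * (hv s + hs v))%:E <= expected_time q [set s] (has A))%E.
Proof.
move=> hsP hvP Av; have [hs0 _ _] := hsP; have [hv0 _ _] := hvP.
(* The shift by [hs v] makes [f v] vanish and [f s] equal to [hv s + hs v]. *)
pose f u := hv u - hs u + hs v.
(* This default leaves the minimum over [[set s]] equal to [f s] and bounds [m] from above, as
   [expected_time_ge] requires. *)
pose a := f s.
pose m (I : {set V}) := \big[Num.min/a]_(u in I) f u.
have lap u : \sum_w (e u w)%:R * (f u - f w) <= D * (u == s)%:R.
  have -> : \sum_w (e u w)%:R * (f u - f w) =
      \sum_w (e u w)%:R * (hv u - hv w) - \sum_w (e u w)%:R * (hs u - hs w).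
    rewrite -sumrB; apply: eq_bigr => w _; rewrite -mulrBr; congr (_ * _).
    by rewrite /f; lra.
  rewrite (laplacian_hitting _ hsP) (laplacian_hitting _ hvP).
  have : 0 <= D * (u == v)%:R by rewrite mulr_ge0 // ltW ?degree_sum_gt0.
  by move=> *; lra.
have k0 : 0 < delta / D by rewrite divr_gt0 ?min_degree_gt0R ?degree_sum_gt0.
have -> : hv s + hs v = m [set s].
  have -> : hv s + hs v = a by rewrite /a /f hs0 subr0.
  apply/le_anti; rewrite bigmin_le_id andbT.
  by apply: le_bigmin => // u; rewrite inE => /eqP ->.
apply: (@expected_time_ge _ _ _ _ _ push_step_ge0 push_step_sum1
  (fun w => delta / D * m (last [set s] w)) (delta / D * a)) => w.
- by rewrite ler_pM2l //; exact: bigmin_le_id.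
- move=> _; set I := last _ w.
  under eq_bigr do rewrite last_rcons mulrCA.
  rewrite -mulr_sumr -lerBlDl.
  have := push_min_drift I a lap; rewrite -(ler_pM2l k0) mulrBr.
  suff -> : delta / D * (D / delta) = 1 by [].
  by rewrite mulrA divfK ?divff ?gt_eqF ?min_degree_gt0R ?degree_sum_gt0.
move=> st; rewrite pmulr_rle0 //.
suff vI : v \in last [set s] w.
  apply: le_trans (bigmin_le_cond _ _ vI) _.
  by rewrite /f hv0 sub0r addNr.
(* At the stopping time the last informed set itself satisfies [A]: an earlier one would have
   stopped the process before. *)
case/lastP: w st => [|w I] /andP[].
  by move=> /= /orP[/Av|].
rewrite last_rcons -rcons_cons has_rcons => /orP[/Av //|hasA] /forallP.
have sw : (size w < size (rcons w I))%N by rewrite size_rcons.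
move=> /(_ (Ordinal sw)) /=.
by rewrite -cats1 take_size_cat // => /negP [].
Qed.

Lemma hitting_le_rba_time s v hs hv :
  hitting_solution s hs -> hitting_solution v hv ->
  ((delta / D * (hv s + hs v))%:E <= @rba_time R V e s v)%E.
Proof. by move=> hsP hvP; apply: push_time_ge. Qed.

Lemma hitting_le_rba_time_from s v hs hv :
  hitting_solution s hs -> hitting_solution v hv ->
  ((delta / D * (hv s + hs v))%:E <= @rba_time_from R V e s)%E.
Proof.
move=> hsP hvP; rewrite /rba_time_from.
under [X in expected_time _ _ X]boolp.funext do rewrite -has_pred1.
by apply: push_time_ge => // I /eqP ->; rewrite inE.
Qed.

(** * Upper bound on the cover time by a logarithmic potential *)

Lemma cover_time_from_le (h : V -> V -> R) (H : R) s :
  (forall v, hitting_solution v (h v)) -> 0 < H ->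
  (forall v u, h v u <= H) ->
  (@cover_time_from R V e s <= (9 * H * ln #|V|%:R)%:E)%E.
Proof.
move=> hP H0 hH.
pose g u y := 1 + h u y / H.
have g1 u y : 1 <= g u y.
  by rewrite lerDl; have [_ _ h0] := hP u; rewrite divr_ge0 // ltW.
have g2 u y : g u y <= 2.
  have : h u y / H <= 1 by rewrite ler_pdivrMr // mul1r.
  by rewrite /g => ?; lra.
have g_ge0 u y : 0 <= g u y by apply: le_trans (g1 u y).
pose G (w : seq V) y := \sum_(u | u \notin s :: w) g u y.
have G_ge0 w y : 0 <= G w y by apply: sumr_ge0.
(* The summand 1 keeps the logarithm defined and nonnegative even when every vertex is visited. *)
pose F w := 3 * H * ln (1 + G w (last s w)).
have F0 : F [::] <= 9 * H * ln #|V|%:R.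
  (* Since 1 + 2n <= n^3 for n >= 2, the initial value is at most 3 H ln(n^3). *)
  have -> : 9 * H * ln #|V|%:R = 3 * H * ln (#|V|%:R ^+ 3).
    by rewrite lnXn ?ltr0n ?(ltn_trans _ V2) // -mulr_natr; lra.
  rewrite ler_pM2l ?mulr_gt0 // ler_ln ?posrE; last 2 first.
  - by apply: lt_le_trans ltr01 _; rewrite lerDl.
  - by rewrite exprn_gt0 // ltr0n (ltn_trans _ V2).
  apply: (@le_trans _ _ (1 + 2 * #|V|%:R)).
    rewrite lerD2l -sum1_card natr_sum mulr_sumr /G big_mkcond.
    by apply: ler_sum => u _; case: ifP => _; rewrite mulr1.
  have n2 : 2 <= #|V|%:R :> R by rewrite (ler_nat _ 2).
  by rewrite exprS expr2; nra.
apply: (@le_trans _ _ (F [::])%:E); last by rewrite lee_fin.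
apply: (expected_time_le walk_step_ge0 walk_step_sum1) => w.
  rewrite /F mulr_ge0 ?mulr_ge0 ?(ltW H0) // ln_ge0 // lerDl //.
rewrite aliveE // => /andP[unvisited _].
set x := last s w; set z := 1 + G w x.
have z0 : 0 < z by apply: lt_le_trans ltr01 _; rewrite lerDl.
pose m := \sum_(u | u \notin s :: w) (1 : R).
have m1 : 1 <= m.
  have /existsP [u uw] : [exists u, u \notin s :: w] by rewrite -negb_forall.
  by rewrite /m (bigD1 u) //= lerDl; apply: sumr_ge0.
have Gm : G w x <= 2 * m.
  by rewrite mulr_sumr; apply: ler_sum => u _; rewrite mulr1.
(* The current vertex is visited, so it differs from each unvisited [u], and the hitting equation
   lowers each of the [m] summands by 1/H in mean. *)
have meanG : \sum_y p x y * G w y = G w x - m / H.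
  under eq_bigr do rewrite mulr_sumr.
  rewrite exchange_big /= mulr_suml -sumrB; apply: eq_bigr => u uw.
  have [_ hS _] := hP u.
  have xu : x != u by apply: contraNneq uw => <-; exact: mem_last.
  rewrite /g (hS x xu); under eq_bigr do rewrite mulrDr mulr1 mulrA.
  by rewrite big_split /= walk_step_sum1 -mulr_suml; field; exact: lt0r_neq0.
(* Visiting [y] can only remove a nonnegative summand; the logarithm then lies below its tangent at
   [z]. *)
have step y : ln (1 + G (rcons w y) y) <= ln z + (1 + G w y) / z - 1.
  have GG : G (rcons w y) y <= G w y.
    rewrite /G big_mkcond [leRHS]big_mkcond /=; apply: ler_sum => u _.
    rewrite -rcons_cons mem_rcons inE negb_or.
    by case: (u == y); case: (u \in _) => //=; rewrite ?g_ge0.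
  have y0 : 0 < 1 + G (rcons w y) y.
    by apply: lt_le_trans ltr01 _; rewrite lerDl.
  have := @le_ln1Dx R ((1 + G (rcons w y) y) / z - 1).
  rewrite [1 + (_ - 1)]addrC subrK ln_div ?posrE //.
  have yz : 0 < (1 + G (rcons w y) y) / z by rewrite divr_gt0.
  have : (1 + G (rcons w y) y) / z <= (1 + G w y) / z.
    by rewrite ler_pM2r ?invr_gt0 // lerD2l.
  by move=> ? /(_ ltac:(lra)) ?; lra.
have : \sum_y p x y * F (rcons w y) <=
    \sum_y p x y * (3 * H * (ln z + (1 + G w y) / z - 1)).
  apply: ler_sum => y _; apply: ler_wpM2l; first exact: walk_step_ge0.
  by rewrite /F last_rcons ler_wpM2l // mulr_ge0 // ltW.
have -> : \sum_y p x y * (3 * H * (ln z + (1 + G w y) / z - 1)) =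
    3 * H * (ln z + (z - m / H) / z - 1).
  transitivity (3 * H * (\sum_y p x y * (ln z + z^-1 - 1) +
      (\sum_y p x y * G w y) / z)).
    rewrite mulr_suml -big_split /= mulr_sumr; apply: eq_bigr => y _.
    by rewrite mulrDl mul1r; ring.
  rewrite -mulr_suml walk_step_sum1 meanG mul1r; congr (_ * _).
  by rewrite /z; field; rewrite lt0r_neq0 ?lt0r_neq0.
have -> : 3 * H * (ln z + (z - m / H) / z - 1) = F w - 3 * (m / z).
  by rewrite /F -/x -/z; field; rewrite !lt0r_neq0.
(* As [m] is at least 1, z <= 1 + 2m <= 3m; this fixes the factor 3 in [F]. *)
have : 1 <= 3 * (m / z).
  by rewrite mulrA ler_pdivlMr // mul1r /z; lra.
by move=> *; lra.
Qed.

(** * Commute and cover times against broadcast times *)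

Lemma broadcast_time_ge s v hs hv :
  hitting_solution s hs -> hitting_solution v hv ->
  ((delta / D * (hv s + hs v))%:E <= @broadcast_time R V e)%E.
Proof.
move=> hsP hvP; apply: le_trans (hitting_le_rba_time_from hsP hvP) _.
exact: le_bigmax_cond.
Qed.

Lemma hitting_solution_ge1 v h u : hitting_solution v h -> u != v -> 1 <= h u.
Proof.
move=> [_ hS h0] /hS ->; rewrite lerDl; apply: sumr_ge0 => w _.
by rewrite mulr_ge0 // walk_step_ge0.
Qed.

Lemma broadcast_time_gt0 : (0 < @broadcast_time R V e)%E.
Proof.
have /card_gt1P [s [v [_ _ sv]]] : (1 < #|V|)%N := V2.
have [hs hsP] := hitting_solution_exists s.
have [hv hvP] := hitting_solution_exists v.
apply: lt_le_trans (broadcast_time_ge hsP hvP); rewrite lte_fin.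
rewrite mulr_gt0 ?divr_gt0 ?min_degree_gt0R ?degree_sum_gt0 //.
have := hitting_solution_ge1 hvP sv; have [_ _ /(_ v)] := hsP.
by move=> *; lra.
Qed.

Lemma commute_time_le s v :
  (@commute_time R V e s v <=
    (4 * (#|edges e|%:R / delta))%:E * @rba_time R V e s v)%E.
Proof.
have [hs hsP] := hitting_solution_exists s.
have [hv hvP] := hitting_solution_exists v.
have le_h : (@commute_time R V e s v <= (hv s + hs v)%:E)%E.
  by rewrite EFinD; apply: leeD; apply: hitting_time_le.
apply: le_trans le_h _.
have rba := hitting_le_rba_time hsP hvP.
have rba0 : (0 <= @rba_time R V e s v)%E.
  apply: le_trans rba; rewrite lee_fin mulr_ge0 ?addr_ge0 //.
  - by rewrite divr_ge0 ?ltW ?min_degree_gt0R ?degree_sum_gt0.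
  - by have [_ _] := hvP.
  - by have [_ _] := hsP.
apply: (@le_trans _ _ ((D / delta)%:E * @rba_time R V e s v)%E).
  have -> : hv s + hs v = D / delta * (delta / D * (hv s + hs v)).
    by field; rewrite !lt0r_neq0 ?min_degree_gt0R ?degree_sum_gt0.
  rewrite EFinM; apply: lee_wpmul2l => //.
  by rewrite lee_fin divr_ge0 ?ltW ?min_degree_gt0R ?degree_sum_gt0.
apply: lee_wpmul2r => //; rewrite lee_fin mulrA.
by rewrite ler_pM2r ?degree_sum_le // invr_gt0 min_degree_gt0R.
Qed.

Lemma ln_card_gt0 : 0 < ln (#|V|%:R) :> R.
Proof. by rewrite ln_gt0 // ltr1n. Qed.

Lemma cover_time_le :
  (@cover_time R V e <=
    (36 * (#|edges e|%:R / delta) * ln #|V|%:R)%:E * @broadcast_time R V e)%E.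
Proof.
have K0 : 0 < 36 * (#|edges e|%:R / delta) * ln #|V|%:R :> R.
  have := degree_sum_gt0; have := degree_sum_le => /[swap] /lt_le_trans /[apply].
  by rewrite pmulr_rgt0 // => E0;
    rewrite !mulr_gt0 ?ln_card_gt0 ?invr_gt0 ?min_degree_gt0R.
have := broadcast_time_gt0; have := @broadcast_time_ge.
(* The coefficient is positive, so an infinite broadcast time makes the right side +oo. *)
case: broadcast_time => [b| |] // hge; last by rewrite gt0_muley ?leey.
rewrite lte_fin => b0.
have [h hP] := choice hitting_solution_exists.
(* This is the uniform bound [H] on hitting times: the lower bound on the broadcast time controls
   [h v u + h u v], and the second term is nonnegative. *)
have H0 : 0 < D / delta * b.
  by rewrite !mulr_gt0 ?invr_gt0 ?min_degree_gt0R ?degree_sum_gt0.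
apply: bigmax_le => [|s _]; first by rewrite leNye.
have hH v u : h v u <= D / delta * b.
  have [->|uv] := eqVneq u v; first by have [-> _ _] := hP v; exact: ltW.
  have := hge u v _ _ (hP u) (hP v); rewrite lee_fin mulrAC.
  rewrite ler_pdivrMr ?degree_sum_gt0 // => le_b.
  rewrite mulrAC ler_pdivlMr ?min_degree_gt0R // [D * b]mulrC.
  apply: le_trans le_b; rewrite mulrC ler_pM2l ?min_degree_gt0R //.
  by rewrite lerDl; have [_ _] := hP u.
apply: le_trans (cover_time_from_le s hP H0 hH) _.
rewrite -EFinM lee_fin.
(* 36 = 9 * 4: the 9 of the cover time bound and the 4 of [degree_sum_le]. *)
have -> : 36 * (#|edges e|%:R / delta) * ln #|V|%:R * b =
  9 * (4 * #|edges e|%:R / delta * b) * ln #|V|%:R by lra.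
rewrite ler_pM2r ?ln_card_gt0 // ler_pM2l // ler_pM2r // ler_pM2r.
  exact: degree_sum_le.
by rewrite invr_gt0 min_degree_gt0R.
Qed.

End WalkAndPush.

Theorem theorem3p8 (R : realType) :
  [/\ forall (V : finType) (e : rel V) (s v : V),
        connected_graph e -> (2 <= #|V|)%N -> s != v ->
        (commute_time e s v <=
          (4 * (#|edges e|%:R / (min_degree e)%:R))%:E
            * rba_time e s v :> \bar R)%E,
      exists2 C : R, 0 < C &
        forall (V : finType) (e : rel V),
          connected_graph e -> (2 <= #|V|)%N ->
          (cover_time e <=
            (C * (#|edges e|%:R / (min_degree e)%:R) * ln #|V|%:R)%:E
              * broadcast_time e :> \bar R)%E
    & exists2 C : R, 0 < C &
        forall (V : finType) (e : rel V),
          connected_graph e -> (2 <= #|V|)%N ->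
          (cover_broadcast_ratio e <=
            (C * (#|edges e|%:R / (min_degree e)%:R) * ln #|V|%:R)%:E
              :> \bar R)%E].
Proof.
split.
- by move=> V e s v conn V2 _; exact: commute_time_le.
- by exists 36 => // V e conn V2; exact: cover_time_le.
exists 36 => // V e conn V2.
have K0 : 0 <= 36 * (#|edges e|%:R / (min_degree e)%:R) * ln #|V|%:R :> R.
  by rewrite !mulr_ge0 ?invr_ge0 // ltW // ln_card_gt0.
have := cover_time_le R conn V2; have := broadcast_time_gt0 R conn V2.
(* A finite positive broadcast time is moved across the inequality; an infinite one has inverse 0,
   so the ratio is 0. *)
rewrite /cover_broadcast_ratio; case: broadcast_time => [b| |] // b0.
  by rewrite inver gt_eqF ?lee_pdivrMr -?lte_fin.
by rewrite invey mule0 lee_fin.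
Qed.
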